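(* Let $X$ be a topological space with $|X|<\mathfrak{d}$. Then: (1) if $X$ is star-Lindelöf, then $X$ is star-Scheepers; (2) if $X$ is strongly star-Lindelöf, then $X$ is strongly star-Scheepers.
   Context: For $A\subseteq X$ and a family $\mathcal{P}$ of subsets of $X$, $St(A,\mathcal{P})=\bigcup\{B\in\mathcal{P} : A\cap B\neq\emptyset\}$. An $\omega$-cover of $X$ is an open cover $\mathcal{U}$ such that every finite $F\subseteq X$ is contained in some member of $\mathcal{U}$. $X$ is star-Lindelöf if for every open cover $\mathcal{U}$ of $X$ there is a countable $\mathcal{V}\subseteq\mathcal{U}$ with $St(\bigcup\mathcal{V},\mathcal{U})=X$; $X$ is strongly star-Lindelöf if for every open cover $\mathcal{U}$ there is a countable $A\subseteq X$ with $St(A,\mathcal{U})=X$. $X$ is star-Scheepers if for each sequence $(\mathcal{U}_n)_{n\in\mathbb{N}}$ of open covers of $X$ there are finite $\mathcal{V}_n\subseteq\mathcal{U}_n$ such that $\{St(\bigcup\mathcal{V}_n,\mathcal{U}_n) : n\in\mathbb{N}\}$ is an $\omega$-cover of $X$ or $St(\bigcup\mathcal{V}_n,\mathcal{U}_n)=X$ for some $n$. $X$ is strongly star-Scheepers if for each sequence $(\mathcal{U}_n)_{n\in\mathbb{N}}$ of open covers of $X$ there are finite sets $F_n\subseteq X$ such that $\{St(F_n,\mathcal{U}_n) : n\in\mathbb{N}\}$ is an $\omega$-cover of $X$. $\mathfrak{d}$ is the minimum cardinality of a dominating subset of $\mathbb{N}^{\mathbb{N}}$, where $D$ is dominating if for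 every $g\in\mathbb{N}^{\mathbb{N}}$ there is $f\in D$ with $g(n)\leq f(n)$ for all but finitely many $n$. *)

(* Defs.v *)
From mathcomp Require Import all_boot all_order.
From mathcomp Require Import boolp classical_sets functions cardinality filter topology.

Set Implicit Arguments.
Unset Strict Implicit.
Unset Printing Implicit Defensive.

Local Open Scope classical_set_scope.
Local Open Scope card_scope.

Definition card_lt {T U : Type} (A : set T) (B : set U) : bool :=
  (A #<= B) && (A #!= B).

Definition dominating (D : set (nat -> nat)) : Prop :=
  forall g : nat -> nat, exists2 f, D f & \forall n \near \oo, (g n <= f n)%N.

Lemma dominating_setT : dominating [set: nat -> nat].
Proof. by move=> g; exists g => //; exact: nearW. Qed.

(* Cardinals are well-ordered: apply Zorn's lemma to the sets G of choice
   functions for the family P that are injective in every coordinate.  For a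
   maximal G, evaluation at some D in P maps G onto D. *)
Lemma exists_card_min (T : Type) (P : set (set T)) :
  P !=set0 -> exists2 D, P D & forall E, P E -> D #<= E.
Proof.
move=> [D0 PD0].
pose Q (G : set (set T -> T)) :=
  (forall g, G g -> forall D, P D -> D (g D)) /\
  (forall g h, G g -> G h -> forall D, P D -> g D = h D -> g = h).
have [G [[Gin Ginj] Gmax]] : exists G, Q G /\ forall H, G `<` H -> ~ Q H.
  apply: Zorn_bigcup => F FQ Ftot; split.
    by move=> g [G FG Gg] D PD; exact: (FQ G FG).1 g Gg D PD.
  move=> g h [G FG Gg] [H FH Hh] D PD gh.
  have [GH|HG] := Ftot _ _ FG FH.
    exact: (FQ H FH).2 g h (GH _ Gg) Hh D PD gh.
  exact: (FQ G FG).2 g h Gg (HG _ Hh) D PD gh.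
have [[D PD DG]|noD] := pselect (exists2 D, P D &
    D `<=` [set g D | g in G]).
  exists D => // E PE.
  have /choice[s sP] : forall x : T, exists g, D x -> G g /\ g D = x.
    move=> x; have [/DG[g Gg gx]|nDx] := pselect (D x); first by exists g.
    by exists (fun=> x).
  have [f] : $|{injfun D >-> E}|.
    apply/injfunPex; exists (s^~ E) => [x /sP[Gs _]|x y]; first exact: (Gin _ Gs).
    move=> /set_mem /sP[Gx xD] /set_mem /sP[Gy yD] sxy.
    by rewrite -xD -yD (Ginj _ _ Gx Gy E PE sxy).
  exact: inj_card_le f.
have /choice[k kP] : forall D : set T, exists x : T, P D ->
    D x /\ forall g, G g -> g D <> x.
  move=> D; have [PD|nPD] := pselect (P D).
    apply: contrapT => no; apply: noD; exists D => // x Dx.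
    apply: contrapT => nx; apply: no; exists x => _; split=> // g Gg gx.
    by apply: nx; exists g.
  have [t _] : [set: T] !=set0.
    apply: contrapT => T0; apply: noD; exists D0 => // x _.
    by exfalso; apply: T0; exists x.
  by exists t.
exfalso; apply: (Gmax (G `|` [set k])).
  split; first exact: subsetUl.
  by move=> /(_ k (or_intror erefl)) Gk; exact: (kP D0 PD0).2 k Gk erefl.
split=> [g [/Gin//|->] D PD|g h [Gg|->] [Gh|->] D PD gh //].
- exact: (kP D PD).1.
- exact: Ginj gh.
- by have := (kP D PD).2 g Gg gh.
- by have := (kP D PD).2 h Gh (esym gh).
Qed.

(* The cardinal is represented by a dominating set of minimum cardinality. *)
Definition dominating_number : set (nat -> nat) :=
  s2val (cid2 (exists_card_min (ex_intro dominating _ dominating_setT))).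

Lemma dominating_number_dominating : dominating dominating_number.
Proof. by rewrite /dominating_number; case: cid2. Qed.

Lemma dominating_number_min D : dominating D -> dominating_number #<= D.
Proof. by rewrite /dominating_number; case: cid2 => /= E _; apply. Qed.

Definition star {X : Type} (A : set X) (P : set (set X)) : set X :=
  \bigcup_(B in [set B | P B /\ A `&` B !=set0]) B.

Section covers.
Variable X : topologicalType.
Implicit Types U V : set (set X).

Definition open_cover U : Prop :=
  U `<=` open /\ \bigcup_(A in U) A = [set: X].

Definition omega_cover U : Prop :=
  open_cover U /\
  forall F : set X, finite_set F -> exists2 A, U A & F `<=` A.

End covers.

Definition star_lindelof (X : topologicalType) : Prop :=
  forall U : set (set X), open_cover U ->
  exists V : set (set X), [/\ V `<=` U, countable V &
    star (\bigcup_(A in V) A) U = [set: X]].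

Definition strongly_star_lindelof (X : topologicalType) : Prop :=
  forall U : set (set X), open_cover U ->
  exists2 A : set X, countable A & star A U = [set: X].

Definition star_scheepers (X : topologicalType) : Prop :=
  forall U : nat -> set (set X), (forall n, open_cover (U n)) ->
  exists V : nat -> set (set X),
    (forall n, V n `<=` U n /\ finite_set (V n)) /\
    (omega_cover (range (fun n => star (\bigcup_(A in V n) A) (U n))) \/
     exists n, star (\bigcup_(A in V n) A) (U n) = [set: X]).

Definition strongly_star_scheepers (X : topologicalType) : Prop :=
  forall U : nat -> set (set X), (forall n, open_cover (U n)) ->
  exists F : nat -> set X,
    (forall n, finite_set (F n)) /\
    omega_cover (range (fun n => star (F n) (U n))).

(* Main.v *)
(** For each n, enumerate a countable subfamily A_n whose star with respect to
    U_n is X, and let f_x(n) be an index of an element of A_n whose star contains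
    x.  The maxima of the f_x over the finite subsets of X form a family of at
    most |X| functions when X is infinite, because |X x X| = |X|; hence this
    family is not dominating.  A function g which is not dominated by any of them
    yields finite sets, the first g(n) elements of A_n, such that each finite
    subset of X is contained in one of their stars.  The equality |X x X| = |X|
    comes from Zorn's lemma. *)
Require Import Defs.
From mathcomp Require Import all_boot all_order.
From mathcomp Require Import boolp classical_sets functions cardinality filter topology.

Local Open Scope classical_set_scope.
Local Open Scope card_scope.

(** * Comparison of cardinals *)

Lemma card_le_setX {T T' : Type} {U U' : pointedType}
    {A : set T} {A' : set T'} {B : set U} {B' : set U'} :
  A #<= B -> A' #<= B' -> A `*` A' #<= B `*` B'.
Proof.
move=> /pcard_leP/injfunPex[f fAB finj] /pcard_leP/injfunPex[g gAB ginj].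
apply/pcard_leP/injfunPex; exists (fun u => (f u.1, g u.2)).
  by move=> u [/fAB ? /gAB ?]; split.
move=> [x x'] [y y'] /set_mem/=[Ax Ax'] /set_mem/=[Ay Ay'] [fxy gxy].
by congr pair; [apply: finj fxy | apply: ginj gxy]; exact: mem_set.
Qed.

(** A least cardinal exists in the family consisting of [A] and [B]. *)
Lemma card_le_total (T : Type) (A B : set T) : A #<= B \/ B #<= A.
Proof.
have [|D [|]-> Dmin] := @exists_card_min T [set D | D = A \/ D = B].
- by exists A; left.
- by left; apply: Dmin; right.
- by right; apply: Dmin; left.
Qed.

(** The tags [a] and [b] keep apart the copies of [A] and of [B] minus [A] inside [A * A], which is
    then injected into [A]. *)
Lemma card_leU_of_square (T : pointedType) (A B : set T) (a b : T) :
  A a -> A b -> a <> b -> A `*` A #<= A -> B #<= A -> A `|` B #<= A.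
Proof.
move=> Aa Ab neqab /pcard_leP/injfunPex[p pA pinj].
move=> /pcard_leP/injfunPex[j jA jinj].
pose k x := if pselect (A x) then (a, x) else (b, j x).
have kA x : (A `|` B) x -> (A `*` A) (k x).
  by rewrite /k; case: pselect => Ax [] //= Bx; split=> //; exact: jA.
apply/pcard_leP/injfunPex; exists (p \o k) => [x /kA /pA //|x y].
move=> /set_mem Dx /set_mem Dy /pinj.
move=> /(_ (mem_set (kA _ Dx)) (mem_set (kA _ Dy))); rewrite /k.
case: pselect Dx => Ax Dx; case: pselect Dy => Ay Dy [] // => [/esym|jxy] //.
by case: Dx Dy => [//|Bx] [//|By]; apply: jinj jxy; exact: mem_set.
Qed.

(** * The square of an infinite set *)

Section infinite_square.
Variable T : pointedType.
Implicit Types (R : set (T * T * T)).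

(** Reading the domain off the diagonal makes [R] the only datum, so that Zorn's lemma applies to
    plain inclusion of graphs. *)
Definition diag_dom R : set T := [set x | exists z, R (x, x, z)].

(* The reversed graph {(x, y, z)} of a surjection z |-> (x, y) from part of the
   diagonal domain A of R onto A * A.  R need not be functional: an injection
   from A * A to A is then obtained by choice. *)
Definition square_graph R : Prop := [/\
  forall x y z, R (x, y, z) -> [/\ diag_dom R x, diag_dom R y & diag_dom R z],
  forall x y, diag_dom R x -> diag_dom R y -> exists z, R (x, y, z) &
  forall u v z, R (u, z) -> R (v, z) -> u = v].

Lemma diag_dom_sub R R' : R `<=` R' -> diag_dom R `<=` diag_dom R'.
Proof. by move=> RR' x [z /RR' ?]; exists z. Qed.

(** This is the chain condition for Zorn's lemma: each clause involves at most two triples, and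
    these lie in a common member of the chain. *)
Lemma square_graph_bigcup (F : set (set (T * T * T))) :
  F `<=` square_graph -> total_on F subset ->
  square_graph (\bigcup_(R in F) R).
Proof.
move=> Fsq Ftot.
have Fdom R : F R -> diag_dom R `<=` diag_dom (\bigcup_(R in F) R).
  by move=> FR; apply: diag_dom_sub => u Ru; exists R.
have Fdir R R' : F R -> F R' -> exists S, [/\ F S, R `<=` S & R' `<=` S].
  by move=> FR FR'; have [?|?] := Ftot _ _ FR FR'; [exists R' | exists R]; split.
split=> [x y z [R FR Rxyz]|x y [z [R FR Rz]] [z' [R' FR' Rz']]|u v z].
- have [sub _ _] := Fsq _ FR.
  by have [? ? ?] := sub _ _ _ Rxyz; split; exact: (Fdom R).
- have [S [FS RS RS']] := Fdir _ _ FR FR'.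
  have [_ tot _] := Fsq _ FS.
  have [||t St] := tot x y; [by exists z; exact: RS|by exists z'; exact: RS'|].
  by exists t, S.
- move=> [R FR Ru] [R' FR' Rv].
  have [S [FS RS RS']] := Fdir _ _ FR FR'.
  have [_ _ inj] := Fsq _ FS.
  exact: inj (RS _ Ru) (RS' _ Rv).
Qed.

Lemma square_graph_card R :
  square_graph R -> diag_dom R `*` diag_dom R #<= diag_dom R.
Proof.
move=> [sub tot inj].
have /choice[p pR] : forall u : T * T, exists z,
    (diag_dom R `*` diag_dom R) u -> R (u, z).
  move=> [x y]; have [[/= Ax Ay]|nA] :=
    pselect ((diag_dom R `*` diag_dom R) (x, y)); last by exists point.
  by have [z Rz] := tot x y Ax Ay; exists z.
apply/pcard_leP/injfunPex; exists p => [[x y] /pR /sub[] //|u v].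
move=> /set_mem/pR Ru /set_mem/pR Rv puv.
by apply: inj Ru _; rewrite puv.
Qed.

(** An injective pairing on [nat], transported along an injection [e] into [T], provides the
    starting point for Zorn's lemma. *)
Lemma square_graph_nat : infinite_set [set: T] ->
  exists2 R, square_graph R & R !=set0 /\ infinite_set (diag_dom R).
Proof.
move=> /infiniteP/pcard_injP[e einj].
have {}einj : injective e by move=> m n; apply: einj; rewrite inE.
have := card_nat2; rewrite card_eq_le => /andP[/pcard_injP[p pinj] _].
have {}pinj : injective p by move=> m n; apply: pinj; rewrite inE.
pose R := range (fun u : nat * nat => (e u.1, e u.2, e (p u))).
have domR x : diag_dom R x <-> range e x.
  split=> [[z [u _ [<- _ _]]]|[n _ <-]]; first by exists u.1.
  by exists (e (p (n, n))), (n, n).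
exists R; first split.
- by move=> x y z [u _ [<- <- <-]]; split; apply/domR; eexists.
- move=> x y /domR[m _ <-] /domR[n _ <-].
  by exists (e (p (m, n))), (m, n).
- move=> [x y] [x' y'] z [u _ [<- <- <-]] [v _ [<- <-]] /einj/pinj ->.
  by [].
split; first by exists (e 0, e 0, e (p (0, 0))), (0, 0).
apply/infiniteP/pcard_leP/injfunPex; exists e => [n _|m n _ _ /einj //].
by apply/domR; exists n.
Qed.

(* A set disjoint from the domain A and equipotent to it has room for the images
   of the pairs in (A + B)^2 that are not in A^2. *)
Lemma square_graph_extend R :
  square_graph R -> infinite_set (diag_dom R) ->
  diag_dom R #<= ~` diag_dom R -> exists2 R', R `<` R' & square_graph R'.
Proof.
move=> Rsq Ainf; have Acard := square_graph_card R Rsq.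
move: Rsq => [sub tot inj]; set A := diag_dom R in sub tot Acard Ainf *.
move=> /pcard_leP/injfunPex[j jA jinj].
have /infiniteP/pcard_leP/injfunPex[e eA einj] := Ainf.
have e01 : e 0 <> e 1 by move=> /einj; rewrite !inE => /(_ I I).
pose D := A `|` j @` A.
have DA : D #<= A.
  apply: (@card_leU_of_square T A (j @` A) (e 0) (e 1)) => //; try exact: eA.
  exact: card_image_le.
have /pcard_leP/injfunPex[h hA hinj] :=
  card_le_trans (card_le_setX DA DA) Acard.
pose N := [set t : T * T * T |
  [/\ (D `*` D) t.1, ~ (A `*` A) t.1 & t.2 = j (h t.1)]].
have NA t : N t -> ~ A t.2 by move=> [Dt _ ->]; exact/jA/hA.
have domD x : diag_dom (R `|` N) x <-> D x.
  split=> [[z [Rz|[[]]//]]|Dx]; first by left; exists z.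
  have [Ax|nAx] := pselect (A x).
    by have [z Rz] := Ax; exists z; left.
  by exists (j (h (x, x))); right; split=> // -[].
exists (R `|` N).
  split; first exact: subsetUl.
  (* The extension is strict because [j (e 0)] is in the new domain but not in [A]. *)
  move=> RNR; have jD : D (j (e 0)) by right; exists (e 0) => //; exact: eA.
  apply: (jA (e 0) (eA 0 I)); have [z [Rz|Nz]] := (domD _).2 jD; first by exists z.
  by exists z; apply: RNR; right.
split.
- move=> x y z [/sub[Ax Ay Az]|[[/= Dx Dy] _ /= ->]].
    by split; apply/domD; left.
  by split; apply/domD => //; right; exists (h (x, y)) => //; exact: hA.
- move=> x y /domD Dx /domD Dy.
  have [[Ax Ay]|nA] := pselect (A x /\ A y).
    by have [z Rz] := tot x y Ax Ay; exists z; left.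
  by exists (j (h (x, y))); right; split.
- move=> [x y] [x' y'] z [Ru|Nu] [Rv|Nv].
  + exact: inj Ru Rv.
  + by have [_ _ /(NA _ Nv)] := sub _ _ _ Ru.
  + by have [_ _ /(NA _ Nu)] := sub _ _ _ Rv.
  + case: Nu Nv => /= Du _ -> [/= Dv _] /jinj jhh.
    apply: hinj; [exact: mem_set|exact: mem_set|apply: jhh; apply: mem_set].
      exact: hA.
    exact: hA.
Qed.

End infinite_square.

Lemma infinite_card_square (T : Type) :
  infinite_set [set: T] -> [set: T * T] #<= [set: T].
Proof.
elim/Ppointed: T => T; first by rewrite emptyE => /(_ (finite_set0 T)).
move=> Tinf; have [R0 R0sq [R00 R0inf]] := square_graph_nat T Tinf.
(* The union of the empty chain is empty and must satisfy [Q], so [R0] is only required inside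
   nonempty graphs. Maximality then rules out the empty graph. *)
pose Q R := square_graph T R /\ (R !=set0 -> R0 `<=` R).
have [R [[Rsq R0R] Rmax]] : exists R, Q R /\ forall R', R `<` R' -> ~ Q R'.
  apply: Zorn_bigcup => F FQ Ftot; split.
    by apply: square_graph_bigcup => // R /FQ[].
  move=> [t [R FR Rt]]; apply: subset_trans (bigcup_sup FR).
  by apply: (FQ R FR).2; exists t.
have {}R0R : R0 `<=` R.
  apply: R0R; apply: contrapT => Re; apply: (Rmax R0).
    split=> [t Rt|R0R0]; first by case: Re; exists t.
    by case: R00 => t /R0R0 Rt; apply: Re; exists t.
  by split=> // _; exact: subset_refl.
have Ainf : infinite_set (diag_dom T R).
  exact: sub_infinite_set (diag_dom_sub _ _ _ R0R) R0inf.
have Acard := square_graph_card T R Rsq.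
set A := diag_dom T R in Ainf Acard.
suff TA : [set: T] #<= A.
  rewrite -setXTT; apply: card_le_trans (card_le_setX TA TA) _.
  exact: card_le_trans Acard (card_leT _).
(* Either the complement has room for a proper extension, against maximality, or it injects into [A]
   and the union with [A] is absorbed. *)
have [AC|CA] := card_le_total T A (~` A).
  have [R' RR' R'sq] := square_graph_extend T R Rsq Ainf AC.
  exfalso; apply: (Rmax R' RR'); split=> // _.
  by apply: subset_trans R0R _; case: RR'.
have /infiniteP/pcard_leP/injfunPex[e eA einj] := Ainf.
rewrite -(setUv A); apply: (@card_leU_of_square _ A _ (e 0) (e 1)) => //.
- exact: eA.
- exact: eA.
- by move=> /einj; rewrite !inE => /(_ I I).
Qed.

(** * Finite sequences and non-dominating families *)

(** Iterated pairing [c] is injective only on sequences of a fixed length, so the length is encoded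
    alongside it. *)
Lemma infinite_card_seq (T : Type) :
  infinite_set [set: T] -> [set: seq T] #<= [set: T].
Proof.
elim/Ppointed: T => T; first by rewrite emptyE => /(_ (finite_set0 T)).
move=> Tinf; have /pcard_injP[p pinj] := infinite_card_square T Tinf.
have {}pinj : injective p by move=> u v; apply: pinj; rewrite inE.
have /infiniteP/pcard_injP[e einj] := Tinf.
have {}einj : injective e by move=> m n; apply: einj; rewrite inE.
pose c := foldr (fun x y => p (x, y)) point.
have cinj s t : size s = size t -> c s = c t -> s = t.
  elim: s t => [|x s IHs] [|y t] //= [st] /pinj[-> /IHs ->] //.
apply/pcard_injP; exists (fun s => p (e (size s), c s)) => s t _ _.
by move=> /pinj[/einj st]; exact: cinj.
Qed.

(* If g failed for some finite F, the pointwise maxima over finite sequences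
   would form a dominating family of cardinality at most |T|. *)
Lemma card_lt_dominating_number_escape (T : choiceType) (f : T -> nat -> nat) :
  card_lt [set: T] dominating_number ->
  exists g : nat -> nat, forall F : set T, finite_set F ->
    exists n, forall x, F x -> (f x n <= g n)%N.
Proof.
move=> /andP[Td nTd]; pose m (s : seq T) n := \max_(x <- s) f x n.
have le_m s x n : x \in s -> (f x n <= m s n)%N.
  by move=> xs; rewrite /m (big_rem x xs) leq_maxl.
have [/finite_seqP[s Ts]|Tinf] := pselect (finite_set [set: T]).
  (* When [T] is finite, the maximum over all of [T] works at every index. *)
  exists (m s) => F _; exists 0 => x _; apply: le_m.
  by have : [set: T] x by []; rewrite Ts.
have : ~ dominating (range m).
  move=> /dominating_number_min dm; move: nTd; rewrite card_eq_le Td /=.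
  move=> /negP; apply; apply: card_le_trans dm _.
  exact: card_le_trans (card_image_le _ _) (infinite_card_seq T Tinf).
move=> /existsNP[g gm]; exists g => F /finite_seqP[s ->].
apply: contrapT => sg; apply: gm; exists (m s); first by exists s.
apply: nearW => n; rewrite leqNgt; apply/negP => mg.
apply: sg; exists n => x /= xs.
exact: leq_trans (le_m _ _ _ xs) (ltnW mg).
Qed.

(** Both parts of the theorem use this with [r n x i] saying that [x] lies in the star of the [i]-th
    set: [I] is [set X] in the first and [X] in the second. *)
Lemma countable_to_finite_selection (T : choiceType) (I : Type)
    (A : nat -> set I) (r : nat -> T -> I -> Prop) :
  card_lt [set: T] dominating_number ->
  (forall n, countable (A n)) ->
  (forall n x, exists2 i, A n i & r n x i) ->
  exists B : nat -> set I,
    (forall n, B n `<=` A n /\ finite_set (B n)) /\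
    forall F : set T, finite_set F ->
      exists n, forall x, F x -> exists2 i, B n i & r n x i.
Proof.
move=> Td Acnt rA.
have /choice[e einj] : forall n, exists e : I -> nat, {in A n &, injective e}.
  by move=> n; exact/countable_injP.
have /choice[f fP] : forall x : T, exists f : nat -> nat,
    forall n, exists i, [/\ A n i, r n x i & e n i = f n].
  move=> x; have /choice[h hP] : forall n, exists i, A n i /\ r n x i.
    by move=> n; have [i ? ?] := rA n x; exists i.
  by exists (fun n => e n (h n)) => n; have [? ?] := hP n; exists (h n).
have [g gP] := card_lt_dominating_number_escape T f Td.
(* Since [e n] is injective on [A n], only finitely many indices have a code at most [g n]. *)
exists (fun n => [set i | A n i /\ (e n i <= g n)%N]); split.
  move=> n; split=> [i []//|].
  apply/finite_set_leP; exists (g n).+1.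
  apply/pcard_leP/injfunPex; exists (e n) => [i [_]|i i'] //=.
  by move=> /set_mem[Ai _] /set_mem[Ai' _]; apply: einj; exact: mem_set.
move=> F /gP[n Fn]; exists n => x /Fn fg.
by have [i [Ai ri ei]] := fP x n; exists i => //; split=> //; rewrite ei.
Qed.

(** * Stars and omega-covers *)

Lemma starS (X : Type) (A B : set X) (P : set (set X)) :
  A `<=` B -> star A P `<=` star B P.
Proof.
move=> AB x [C [PC [y [Ay Cy]]] Cx]; exists C => //; split=> //.
by exists y; split=> //; exact: AB.
Qed.

Lemma star_bigcup (X I : Type) (D : set I) (A : I -> set X) (P : set (set X)) :
  star (\bigcup_(i in D) A i) P = \bigcup_(i in D) star (A i) P.
Proof.
apply/seteqP; split=> [x [C [PC [y [[i Di Ay] Cy]]] Cx]|x [i Di]].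
  by exists i => //; exists C => //; split=> //; exists y.
exact/starS/bigcup_sup.
Qed.

Lemma omega_cover_range (X : topologicalType) (S : nat -> set X) :
  (forall n, open (S n)) ->
  (forall F, finite_set F -> exists n, F `<=` S n) ->
  omega_cover (range S).
Proof.
move=> Sopen SF; split; last by move=> F /SF[n Fn]; exists (S n) => //; exists n.
split=> [_ [n _ <-] //|]; apply/seteqP; split=> // x _.
have [n xS] := SF [set x] (finite_set1 x).
by exists (S n); [exists n|exact: xS].
Qed.

Lemma open_star (X : topologicalType) (A : set X) (U : set (set X)) :
  open_cover U -> open (star A U).
Proof. by move=> [Uop _]; apply: bigcup_open => B [/Uop]. Qed.

Lemma countable_star_omega_cover (X : topologicalType) (I : Type)
    (a : I -> set X) (U : nat -> set (set X)) (A : nat -> set I) :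
  card_lt [set: X] dominating_number ->
  (forall n, open_cover (U n)) ->
  (forall n, countable (A n)) ->
  (forall n, star (\bigcup_(i in A n) a i) (U n) = [set: X]) ->
  exists B : nat -> set I,
    (forall n, B n `<=` A n /\ finite_set (B n)) /\
    omega_cover (range (fun n => star (\bigcup_(i in B n) a i) (U n))).
Proof.
move=> Xd Uc Acnt AU.
have [|B [BA Bom]] := @countable_to_finite_selection X I A
    (fun n x i => star (a i) (U n) x) Xd Acnt.
  move=> n x; have : [set: X] x by [].
  by rewrite -(AU n) star_bigcup => -[i]; exists i.
exists B; split=> //; apply: omega_cover_range => [n|F /Bom[n Fn]].
  exact: open_star.
by exists n => x /Fn[i Bi xi]; rewrite star_bigcup; exists i.
Qed.

Theorem corollary3p11 (X : topologicalType)
    (hX : card_lt [set: X] dominating_number) :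
  (star_lindelof X -> star_scheepers X) /\
  (strongly_star_lindelof X -> strongly_star_scheepers X).
Proof.
split=> lind U Uc.
  have /choice[A AP] := fun n => lind (U n) (Uc n).
  have [n|n|B [BA Bom]] :=
    @countable_star_omega_cover X (set X) id U A hX Uc.
  - by have [] := AP n.
  - by have [] := AP n.
  (* The omega-cover alternative is always the one obtained. *)
  exists B; split; last by left.
  move=> n; have [Bn ?] := BA n; split=> //.
  by have [AU _ _] := AP n; exact: subset_trans AU.
have /choice[A AP] : forall n, exists A : set X,
    countable A /\ star A (U n) = [set: X].
  by move=> n; have [A ? ?] := lind (U n) (Uc n); exists A.
have [n|n|B [BA Bom]] :=
    @countable_star_omega_cover X X (fun x => [set x]) U A hX Uc.
- by have [] := AP n.
- by rewrite bigcup_imset1 image_id; have [] := AP n.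
exists B; split=> [n|]; first by have [] := BA n.
(* Points are handled as singletons, whose union gives back [B n]. *)
have <- : (fun n => star (\bigcup_(x in B n) [set x]) (U n)) =
          (fun n => star (B n) (U n)).
  by apply/funext => n; rewrite bigcup_imset1 image_id.
exact: Bom.
Qed.
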